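(* Let $\nu_0$ be a $\sigma$-finite measure on the initial level $(X_0,\mathcal A_0)$ of a measurable Bratteli diagram $\mathcal B=(X_n,E_n)$. Suppose that $(P_n)_{n\ge0}$ is a sequence of Markov kernels consistent with $\mathcal B$. Then: (a) there exists a sequence of $\sigma$-finite measures $(\nu_n)$, $\nu_n$ a Borel measure on $(X_n,\mathcal A_n)$, such that $\nu_n=\nu_{n+1}Q_n$ and $\nu_{n+1}=\nu_nP_n$, $n\ge 0$ (with $Q_n$ the kernels of (b)); (b) there exists a sequence of transition kernels $(Q_n)$, $Q_n:X_{n+1}\times\mathcal A_n\to[0,\infty)$, such that $(P_n,Q_n)$ form a dual pair for all $n$, i.e. $$d\nu_n(x_n)P_n(x_n,dx_{n+1})=d\nu_{n+1}(x_{n+1})Q_n(x_{n+1},dx_n);$$ (c) there exists a sequence of measures $(\rho_n)$, supported by the sets $E_n$, such that $$\rho_n(A\times B)=\int_Ad\nu_n(x_n)P_n(x_n,B)=\int_Bd\nu_{n+1}(x_{n+1})Q_n(x_{n+1},A),\qquad A\times B\in\mathcal A_n\times\mathcal A_{n+1};$$ (d) for all $n\ge0$, $P_n(x_n,\cdot)\ll\nu_{n+1}$ for $\nu_n$-a.e. $x_n$, and $Q_n(x_{n+1},\cdot)\ll\nu_n$ for $\nu_{n+1}$-a.e. $x_{n+1}$.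
   Context: A measurable Bratteli diagram $\mathcal B=(X_n,E_n)_{n\ge0}$ consists of standard Borel spaces $(X_n,\mathcal A_n)$, each Borel isomorphic to a fixed uncountable standard Borel space $(X,\mathcal A)$, and Borel subsets $E_n\subset X_n\times X_{n+1}$ such that the projections $s:E_n\to X_n$, $s(x,y)=x$, and $r:E_n\to X_{n+1}$, $r(x,y)=y$, are onto Borel maps. A transition kernel $R:Y\times\mathcal C\to[0,\infty)$ between standard Borel spaces $Y$ and $(Y',\mathcal C)$: $y\mapsto R(y,C)$ is Borel for every $C\in\mathcal C$ and $R(y,\cdot)$ is a $\sigma$-finite Borel measure for every $y$. It is a probability (Markov) kernel if each $R(y,\cdot)$ is a probability measure. Kernels act on measures by $(\mu R)(C)=\int R(y,C)\,d\mu(y)$. A sequence of Markov kernels $P_n:X_n\times\mathcal A_{n+1}\to[0,1]$ is consistent with $\mathcal B$ if for every $n\ge0$ and $x\in X_n$, $P_n(x,\cdot)$ is a probability measure on the set $r(s^{-1}(x))\subset X_{n+1}$, i.e. $P_n(x,r(s^{-1}(x)))=1$, and $P_n(x,\cdot)\ll\nu_{n+1}$, where $\nu_{n+1}=\nu_nP_n$ is the measure obtained inductively from the given initial measure $\nu_0$.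
   Formalization: The formal statement additionally assumes that the inductively obtained measures ν_{n+1}=ν_nP_n are σ-finite; without this (a) can fail, e.g. ν_0 Lebesgue measure on the line, E_n everything, and P_n(x,·) a fixed probability measure. *)

(* Defs.v *)
From HB Require Import structures.
From mathcomp Require Import all_boot all_order all_algebra.
From mathcomp Require Import all_classical all_reals all_analysis.

Set Implicit Arguments.
Unset Strict Implicit.
Unset Printing Implicit Defensive.

Import Order.TTheory GRing.Theory Num.Theory.
Import numFieldNormedType.Exports.

Local Open Scope classical_set_scope.
Local Open Scope ring_scope.
Local Open Scope ereal_scope.

Definition polish_metric (R : realType) (Y : metricType R) : Prop :=
  (forall F : set_system Y, ProperFilter F -> cauchy F -> exists y : Y, F --> y) /\
  (exists2 D : set Y, countable D & dense D).

(* [<<s open >>] is the Borel sigma-algebra of [Y], so [f] identifies the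
   measurable space [T] with a Polish space and its Borel sets. *)
Definition standard_borel (R : realType) (d : measure_display)
    (T : measurableType d) : Prop :=
  exists (Y : metricType R) (f : T -> Y),
    [/\ polish_metric Y, bijective f &
        @measurable d T = preimage_set_system setT f <<s (@open Y) >>].

Definition borel_isomorphic (d d' : measure_display)
    (T : measurableType d) (T' : measurableType d') : Prop :=
  exists (f : T -> T') (g : T' -> T),
    [/\ cancel f g, cancel g f, measurable_fun setT f & measurable_fun setT g].

Record measurable_bratteli (R : realType) := MeasurableBratteli {
  base_display : measure_display;
  base : measurableType base_display;
  base_standard : standard_borel R base;
  base_uncountable : ~ countable [set: base];
  level_display : nat -> measure_display;
  level : forall n, measurableType (level_display n);
  level_standard : forall n, standard_borel R (level n);
  level_isomorphic : forall n, borel_isomorphic (level n) base;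
  edge : forall n, set (level n * level n.+1);
  edge_measurable : forall n, measurable (@edge n);
  source_onto : forall n, fst @` @edge n = [set: level n];
  range_onto : forall n, snd @` @edge n = [set: level n.+1] }.

Arguments level {R} B n : rename.
Arguments edge {R} B n : rename.

(* The set r(s^-1(x)). *)
Definition successors (R : realType) (B : measurable_bratteli R) (n : nat)
    (x : level B n) : set (level B n.+1) :=
  snd @` (edge B n `&` fst @^-1` [set x]).

Section kernel_action.
Context (d d' : measure_display) (X : measurableType d) (Y : measurableType d').
Context (R : realType) (mu : {measure set X -> \bar R}) (K : R.-ker X ~> Y).

Definition kernel_action (C : set Y) : \bar R := \int[mu]_x K x C.

Let kernel_action0 : kernel_action set0 = 0.
Proof.
rewrite /kernel_action (eq_integral (cst 0)) ?integral0// => x _.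
by rewrite measure0.
Qed.

Let kernel_action_ge0 C : 0 <= kernel_action C.
Proof. exact: integral_ge0. Qed.

Let kernel_action_sigma_additive : semi_sigma_additive kernel_action.
Proof.
move=> U mU tU mUU; rewrite [X in _ --> X](_ : _ =
  \int[mu]_x (\sum_(n <oo) K x (U n))); last first.
  apply: eq_integral => x _.
  by apply/esym/cvg_lim => //; exact/measure_semi_sigma_additive.
apply/cvg_closeP; split.
  by apply: is_cvg_nneseries => n _ _; exact: integral_ge0.
rewrite closeE// integral_nneseries// => n.
exact: measurable_kernel.
Qed.

HB.instance Definition _ := isMeasure.Build _ _ _ kernel_action
  kernel_action0 kernel_action_ge0 kernel_action_sigma_additive.

End kernel_action.

Fixpoint level_measure (R : realType) (B : measurable_bratteli R)
    (nu0 : {measure set (level B 0) -> \bar R})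
    (P : forall n, R.-pker level B n ~> level B n.+1) (n : nat)
    : {measure set (level B n) -> \bar R} :=
  match n return {measure set (level B n) -> \bar R} with
  | 0%N => nu0
  | m.+1 => kernel_action (level_measure nu0 P m) (P m)
  end.

Definition consistent (R : realType) (B : measurable_bratteli R)
    (nu0 : {measure set (level B 0) -> \bar R})
    (P : forall n, R.-pker level B n ~> level B n.+1) : Prop :=
  forall (n : nat) (x : level B n),
    P n x (successors x) = 1 /\ P n x `<< level_measure nu0 P n.+1.

(* [d mu(x) P(x, dy) = d nu(y) Q(y, dx)] as measures on the product
   sigma-algebra, each side being evaluated by slicing. *)
Definition dual_pair (d d' : measure_display)
    (X : measurableType d) (Y : measurableType d') (R : realType)
    (mu : {measure set X -> \bar R}) (nu : {measure set Y -> \bar R})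
    (P : R.-ker X ~> Y) (Q : R.-ker Y ~> X) : Prop :=
  forall W : set (X * Y), measurable W ->
    \int[mu]_x P x (xsection W x) = \int[nu]_y Q y (ysection W y).

(* Main.v *)
(* Since every [P x] is absolutely continuous with respect to [nu], the joint
   measure [rho W = \int P x (W_x) d mu] is absolutely continuous with respect
   to the product [mu \x nu], so Radon-Nikodym gives it a jointly measurable
   density [p]. By Tonelli, [Q y A = \int_A p(x, y) d mu(x)] is dual to [P], and
   it is visibly dominated by [mu]: no disintegration theorem on standard Borel
   spaces is needed. *)

Require Import Defs.
From HB Require Import structures.
From mathcomp Require Import all_boot all_order all_algebra.
From mathcomp Require Import all_classical all_reals all_analysis.
From mathcomp Require Import measurable_realfun.

Set Implicit Arguments.
Unset Strict Implicit.
Unset Printing Implicit Defensive.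

Local Open Scope classical_set_scope.
Local Open Scope ring_scope.
Local Open Scope ereal_scope.

Import Order.TTheory GRing.Theory Num.Theory.

(** * Sigma-finite measures: densities and products *)

Section sigma_finite_pack.
Context (d : measure_display) (T : measurableType d) (R : realType)
  (mu : {measure set T -> \bar R}) (mufin : sigma_finite setT mu).

Let m : set T -> \bar R := mu.

#[local] HB.instance Definition _ := Measure.on m.

#[local] HB.instance Definition _ := Measure_isSigmaFinite.Build _ _ _ m mufin.

(** Radon-Nikodym and Tonelli are stated for bundled sigma-finite measures; rewriting with this
    equality brings a plain measure into that form. *)
Lemma sigma_finite_pack : exists m' : {sigma_finite_measure set T -> \bar R},
  mu = m' :> {measure set T -> \bar R}.
Proof. by exists m; exact: eq_measure. Qed.

End sigma_finite_pack.

(** Radon-Nikodym for finite [nu] extends by restricting [nu] to countably many disjoint sets [E k]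
    of finite mass and summing the densities obtained. *)
Lemma sigma_finite_density (d : measure_display) (T : measurableType d)
    (R : realType) (mu nu : {measure set T -> \bar R}) :
  sigma_finite setT mu -> sigma_finite setT nu -> nu `<< mu ->
  exists f : T -> \bar R,
    [/\ forall x, 0 <= f x, measurable_fun setT f &
        forall A, measurable A -> nu A = \int[mu]_(x in A) f x].
Proof.
move=> /sigma_finite_pack[m ->].
move=> [F TF /all_and2[mF nuF]] /null_content_dominatesP numu.
pose E := seqDU F.
have mE k : measurable (E k).
  by apply: measurableD => //; exact: bigsetU_measurable.
have nuE k : nu (E k) < +oo.
  by rewrite (le_lt_trans _ (nuF k))// le_measure ?inE//; exact: subDsetl.
have ET : \bigcup_k E k = setT by rewrite TF [RHS]seqDU_bigcup_eq.
have /choice[f fP] k : exists f : T -> \bar R,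
    [/\ forall x, 0 <= f x, measurable_fun setT f &
        forall A, measurable A -> nu (A `&` E k) = \int[m]_(x in A) f x].
  have [|f [f0 _ fi fE]] :=
      @radon_nikodym_sigma_finite _ _ _ m (mfrestr (mE k) (nuE k)).
    apply/null_content_dominatesP => A mA muA.
    rewrite /= /mfrestr /mrestr; apply: (@subset_measure0 _ _ _ _ _ A) => //.
    - exact: measurableI.
    - exact: numu.
  by exists f; split => //; exact: measurable_int fi.
have f0 k x : 0 <= f k x by case: (fP k).
have mf k : measurable_fun setT (f k) by case: (fP k).
exists (fun x => \sum_(k <oo) f k x); split.
- by move=> x; exact: nneseries_ge0.
- exact: ge0_emeasurable_sum.
- move=> A mA; rewrite integral_nneseries//; last first.
    by move=> k; exact: measurable_funTS.
  rewrite -[in LHS](setIT A) -ET setI_bigcupr measure_semi_bigcup//.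
  + by apply: eq_eseriesr => k _; case: (fP k) => _ _ ->.
  + by move=> k; exact: measurableI.
  + exact/trivIset_setIl/trivIset_seqDU.
  + by apply: bigcupT_measurable => k; exact: measurableI.
Qed.

(* The library's canonical instance stating this is masked by the one for
   products of subprobabilities. *)
Lemma sigma_finite_product (d d' : measure_display) (X : measurableType d)
    (Y : measurableType d') (R : realType)
    (mu : {sigma_finite_measure set X -> \bar R})
    (nu : {sigma_finite_measure set Y -> \bar R}) :
  sigma_finite setT (mu \x nu).
Proof.
have /sigma_finiteP[F [TF ndF muF]] := sigma_finiteT mu.
have /sigma_finiteP[G [TG ndG nuG]] := sigma_finiteT nu.
(* Both exhaustions are nondecreasing, so a point with coordinates in [F i] and [G j] lies in the
   rectangle of index [maxn i j]. *)
exists (fun n => F n `*` G n) => [|n].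
  apply/esym/seteqP; split=> // -[x y] _.
  have [i _ Fix] : (\bigcup_n F n) x by rewrite -TF.
  have [j _ Gjy] : (\bigcup_n G n) y by rewrite -TG.
  exists (maxn i j) => //; split => /=.
  - by move: x Fix; exact/subsetPset/ndF/leq_maxl.
  - by move: y Gjy; exact/subsetPset/ndG/leq_maxr.
have [[mF Foo] [mG Goo]] := (muF n, nuG n).
split; first exact: measurableX.
by rewrite product_measure1E// lte_mul_pinfty// ge0_fin_numE.
Qed.

(** * The kernel given by a joint density *)

Section density_kernel.
Context (d d' : measure_display) (X : measurableType d) (Y : measurableType d')
  (R : realType) (mu : {sigma_finite_measure set X -> \bar R})
  (p : X * Y -> \bar R).
Hypotheses (p0 : forall z, 0 <= p z) (mp : measurable_fun setT p).

Definition density (y : Y) (A : set X) : \bar R := \int[mu]_(x in A) p (x, y).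

Let density0 y : density y set0 = 0.
Proof. exact: integral_set0. Qed.

Let density_ge0 y A : 0 <= density y A.
Proof. exact: integral_ge0. Qed.

Let density_sigma_additive y : semi_sigma_additive (density y).
Proof.
move=> F mF tF mUF; rewrite /density ge0_integral_bigcup//; last first.
  exact/measurable_funTS/measurable_fun_pair1.
by apply: is_cvg_nneseries => n _ _; exact: integral_ge0.
Qed.

HB.instance Definition _ y := isMeasure.Build _ _ _ (density y)
  (density0 y) (density_ge0 y) (@density_sigma_additive y).

Definition density_kernel (y : Y) : {measure set X -> \bar R} := density y.

(** This is the inner integral of Tonelli's theorem for [p] cut off outside [W]; measurability in
    [y] and the exchange of integrals both rest on it. *)
Lemma density_ysection W y :
  density y (ysection W y) = fubini_G mu (p \_ W) y.
Proof.
rewrite /fubini_G /density [LHS]integral_mkcond; apply: eq_integral => x _.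
by rewrite !patchE mem_ysection.
Qed.

Lemma measurable_density_ysection W : measurable W ->
  measurable_fun setT (fun y => density y (ysection W y)).
Proof.
move=> mW; under eq_fun do rewrite density_ysection.
apply: measurable_fun_fubini_tonelli_G.
- by apply/(measurable_restrictT _ _).1 => //; exact: measurable_funTS.
- by move=> z; exact: erestrict_ge0.
Qed.

Let measurable_density_kernel U :
  measurable U -> measurable_fun setT (density_kernel ^~ U).
Proof.
move=> mU.
have -> : density_kernel ^~ U = fun y => density y (ysection (U `*` setT) y).
  by apply/funext => y; rewrite in_ysectionX// inE.
by apply: measurable_density_ysection; exact: measurableX.
Qed.

HB.instance Definition _ := isKernel.Build _ _ _ _ _ density_kernel
  measurable_density_kernel.

Lemma density_kernel_dominates y : density_kernel y `<< mu.
Proof.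
apply/null_content_dominatesP => A mA muA; rewrite /= /density.
by rewrite null_set_integral//; exact/measurable_funTS/measurable_fun_pair1.
Qed.

End density_kernel.

(** * The joint measure of [mu] and a kernel *)

Section joint_measure.
Context (d d' : measure_display) (X : measurableType d) (Y : measurableType d')
  (R : realType) (mu : {measure set X -> \bar R}) (P : R.-fker X ~> Y).

Definition joint (W : set (X * Y)) : \bar R := \int[mu]_x P x (xsection W x).

Let joint0 : joint set0 = 0.
Proof. by apply: integral0_eq => x _; rewrite xsection0 measure0. Qed.

Let joint_ge0 W : 0 <= joint W.
Proof. exact: integral_ge0. Qed.

Let joint_sigma_additive : semi_sigma_additive joint.
Proof.
move=> F mF tF mUF; rewrite [X in _ --> X](_ : _ =
  \int[mu]_x (\sum_(n <oo) P x (xsection (F n) x))); last first.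
  apply: eq_integral => x _; rewrite xsection_bigcup measure_semi_bigcup//.
  - by move=> n; exact: measurable_xsection.
  - exact: trivIset_xsection.
  - by rewrite -xsection_bigcup; exact: measurable_xsection.
rewrite integral_nneseries//; last first.
  by move=> n; apply: measurable_fun_xsection_finite_kernel; rewrite inE.
by apply: is_cvg_nneseries => n _ _; exact: integral_ge0.
Qed.

HB.instance Definition _ := isMeasure.Build _ _ _ joint
  joint0 joint_ge0 joint_sigma_additive.

Lemma jointX A C : measurable A -> measurable C ->
  joint (A `*` C) = \int[mu]_(x in A) P x C.
Proof.
move=> mA mC; rewrite /joint [RHS]integral_mkcond; apply: eq_integral => x _.
rewrite patchE; case: ifPn => xA; first by rewrite in_xsectionX.
by rewrite notin_xsectionX// measure0.
Qed.

(** A finite kernel has a uniform bound [r], so the strip over [F n] has mass at most [r] times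
    [mu (F n)]. *)
Lemma sigma_finite_joint : sigma_finite setT mu -> sigma_finite setT joint.
Proof.
move=> [F TF /all_and2[mF muF]]; exists (fun n => F n `*` setT).
  by rewrite -setX_bigcupl -TF setXTT.
move=> n; split; first exact: measurableX.
rewrite jointX//.
have /measure_fam_uubP[r Pr] := measure_uub P.
apply: (@le_lt_trans _ _ (\int[mu]_(x in F n) r%:num%:E)).
  apply: ge0_le_integral => //.
  - exact/measurable_funTS/measurable_kernel.
  - by move=> x _; exact: ltW.
by rewrite integral_cst//; apply: lte_mul_pinfty.
Qed.

(** For [mu]-almost every [x] the slice at [x] of a product-null set is [nu]-null, hence
    [P x]-null. *)
Lemma joint_dominates (nu : {sigma_finite_measure set Y -> \bar R}) :
  (forall x, P x `<< nu) -> joint `<< mu \x nu.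
Proof.
move=> Pnu; apply/null_content_dominatesP => W mW W0.
have mP : measurable_fun setT (fun x => P x (xsection W x)).
  by apply: measurable_fun_xsection_finite_kernel; rewrite inE.
have mnu : measurable_fun setT (nu \o xsection W).
  exact: measurable_fun_xsection.
have /ae_eq_integral_abs : \int[mu]_x `|(nu \o xsection W) x| = 0.
  by rewrite -W0; apply: eq_integral => x _; rewrite gee0_abs.
move=> /(_ measurableT mnu) nuW0.
rewrite /= /joint (@ge0_ae_eq_integral _ _ _ _ _ _ (cst 0)) ?integral0//.
apply: filterS nuW0 => x /(_ Logic.I) nuWx0 _.
have /null_content_dominatesP := Pnu x; apply => //.
exact: measurable_xsection.
Qed.

End joint_measure.

(* For [nu]-almost every [y] the slice [p(-, y)] of the joint density has
   [mu]-mass 1; discarding the other [y] makes [Q y] finite everywhere. *)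
Lemma dual_kernel_exists (d d' : measure_display) (X : measurableType d)
    (Y : measurableType d') (R : realType)
    (mu : {measure set X -> \bar R}) (nu : {measure set Y -> \bar R})
    (P : R.-pker X ~> Y) :
  sigma_finite setT mu -> sigma_finite setT nu ->
  (forall C, measurable C -> nu C = kernel_action mu P C) ->
  (forall x, P x `<< nu) ->
  exists Q : R.-spker Y ~> X, dual_pair mu nu P Q /\ forall y, Q y `<< mu.
Proof.
move=> /sigma_finite_pack[{}mu ->] /sigma_finite_pack[{}nu ->] nuE Pnu.
have [p [p0 mp pE]] :=
  @sigma_finite_density _ (X * Y)%type R (mu \x nu) (joint mu P)
  (sigma_finite_product mu nu) (sigma_finite_joint P (sigma_finiteT mu))
  (joint_dominates Pnu).
(* Tonelli with [mu] as the inner measure: this is already duality, for the kernel of density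
   [p]. *)
have jointE W : measurable W ->
    joint mu P W = \int[nu]_y density mu p y (ysection W y).
  move=> mW; rewrite [LHS]pE// integral_mkcond fubini_tonelli2//.
  - by apply: eq_integral => y _; rewrite density_ysection.
  - by apply/(measurable_restrictT _ _).1 => //; exact: measurable_funTS.
  - by move=> z; exact: erestrict_ge0.
pose M y := density mu p y setT.
have mM : measurable_fun setT M.
  exact: (measurable_kernel (density_kernel mu p0 mp)).
pose G := [set y | M y <= 1].
have mG : measurable G.
  by rewrite -[G]setTI; exact: emeasurable_fun_infty_c.
have aeG : {ae nu, forall y, G y}.
  have [F TF /all_and2[mF nuF]] := sigma_finiteT nu.
  apply: (@negligibleS _ _ _ _ (\bigcup_n (F n `&` ~` G))).
    by rewrite -setI_bigcupl -TF setTI.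
  apply: negligible_bigcup => n.
  (* [cst 1] and [M] both integrate to [nu E] over every measurable [E] in [F n]; finiteness of
     [nu (F n)] makes [cst 1] integrable there. *)
  have : ae_eq nu (F n) (cst 1) M.
    apply: integral_ae_eq => //.
    - apply/integrableP; split => //.
      rewrite (eq_integral (cst 1)) => [|y _ /=]; last by rewrite normr1.
      rewrite integral_cst; [rewrite mul1e; exact: nuF|exact: mF].
    - exact: measurable_funTS.
    - move=> E EF mE; rewrite integral_cst// mul1e [LHS]nuE//.
      (* As [nu] is the image of [mu] under [P], [nu E] is the joint mass of the cylinder over
         [E]. *)
      rewrite /= /kernel_action -jointX// jointE; last exact: measurableX.
      rewrite [RHS]integral_mkcond.
      apply: eq_integral => y _.
      rewrite patchE; case: ifPn => Ey; first by rewrite in_ysectionX.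
      by rewrite notin_ysectionX// /density integral_set0.
  apply: negligibleS => y [Fy +] /(_ Fy) My; apply.
  by rewrite /G /= -My.
(* Outside [G] the kernel becomes the zero measure, so total mass at most 1 holds for every [y]: [Q]
   is a sub-probability kernel. *)
pose q := p \_ (setT `*` G).
have q0 z : 0 <= q z by exact: erestrict_ge0.
have mq : measurable_fun setT q.
  apply/(measurable_restrictT _ _).1; first exact: measurableX.
  exact: measurable_funTS.
have qE y A : G y -> density mu q y A = density mu p y A.
  move=> Gy; apply: eq_integral => x _; rewrite /q patchE ifT// inE.
  by split.
have qM y : density mu q y setT <= 1.
  have [Gy|Gy] := pselect (G y); first by rewrite qE.
  rewrite /density integral0_eq// => x _; rewrite /q patchE ifF//.
  by apply/negbTE; rewrite notin_setE => -[].
pose K := density_kernel mu q0 mq.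
have Kle1 : ereal_sup [set K y setT | y in setT] <= 1 by exact/sprob_kernelP.
pose HQ := Kernel_isSubProbability.Build _ _ _ _ _ K Kle1.
pose Q : R.-spker Y ~> X := HB.pack K HQ.
exists Q; split; last first.
  by move=> y; exact: density_kernel_dominates.
move=> W mW; rewrite -/(joint mu P W) jointE//.
(* The slices of [p] and [q] agree over [G], whose complement is [nu]-negligible, so duality passes
   from [p] to [q]. *)
apply: ge0_ae_eq_integral => //.
- exact: measurable_density_ysection.
- exact: measurable_density_ysection.
- by move=> y _; exact: integral_ge0.
- by apply: filterS aeG => y Gy _; rewrite [RHS]qE.
Qed.

(** * Assembling the levels of the diagram *)

Theorem theorem8p4 (R : realType) (B : measurable_bratteli R)
    (nu0 : {measure set (level B 0) -> \bar R})
    (P : forall n, R.-pker level B n ~> level B n.+1)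
    (nu0_sigma_finite : sigma_finite setT nu0)
    (P_consistent : consistent nu0 P)
    (level_sigma_finite :
      forall n, sigma_finite setT (level_measure nu0 P n.+1)) :
  exists (nu : forall n, {measure set (level B n) -> \bar R})
         (Q : forall n, R.-ftker level B n.+1 ~> level B n)
         (rho : forall n, {measure set (level B n * level B n.+1) -> \bar R}),
    [/\ nu 0%N = nu0,
        (forall n : nat,
          [/\ sigma_finite setT (nu n),
              (forall A, measurable A ->
                nu n A = kernel_action (nu n.+1) (Q n) A) &
              (forall C, measurable C ->
                nu n.+1 C = kernel_action (nu n) (P n) C)]),
        (forall n : nat, dual_pair (nu n) (nu n.+1) (P n) (Q n)),
        (forall n : nat,
          rho n (~` edge B n) = 0 /\
          (forall A C, measurable A -> measurable C ->
            rho n (A `*` C) = \int[nu n]_(x in A) P n x C /\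
            rho n (A `*` C) = \int[nu n.+1]_(y in C) Q n y A)) &
        (forall n : nat,
          {ae nu n, forall x, P n x `<< nu n.+1} /\
          {ae nu n.+1, forall y, Q n y `<< nu n})].
Proof.
pose nu := level_measure nu0 P.
have nufin n : sigma_finite setT (nu n) by case: n => //.
have QP n : {Q : R.-ftker level B n.+1 ~> level B n |
    dual_pair (nu n) (nu n.+1) (P n) Q /\ forall y, Q y `<< nu n}.
  (* One dual kernel is chosen per level; a sub-probability kernel is in particular a finite
     transition kernel. *)
  apply: cid.
  have [||Q] := dual_kernel_exists (nufin n) (nufin n.+1) (P := P n).
  - by [].
  - by move=> x; case: (P_consistent n x).
  - by exists Q.
pose Q n := sval (QP n).
have dualQ n : dual_pair (nu n) (nu n.+1) (P n) (Q n) by case: (svalP (QP n)).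
have Qnu n y : Q n y `<< nu n by case: (svalP (QP n)) => _; exact.
have QE n A C : measurable A -> measurable C ->
    joint (nu n) (P n) (A `*` C) = \int[nu n.+1]_(y in C) Q n y A.
  move=> mA mC; rewrite [LHS]dualQ; last exact: measurableX.
  rewrite [RHS]integral_mkcond; apply: eq_integral => y _.
  rewrite patchE; case: ifPn => yC; first by rewrite in_ysectionX.
  by rewrite notin_ysectionX// measure0.
exists nu, Q, (fun n => joint (nu n) (P n)); split => // n.
(* With [C] the whole space, [QE] gives the joint mass of the cylinder over [A], which is [nu n A]
   because every [P n x] has mass 1. *)
- split=> // A mA; rewrite /= /kernel_action -QE// jointX//.
  under eq_integral do rewrite prob_kernel.
  by rewrite integral_cst// mul1e.
- split=> [|A C mA mC]; last by rewrite -jointX// -QE.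
  apply: integral0_eq => x _.
  (* As a section of [edge B n], the successor set is measurable; consistency gives it mass 1, so
     the complementary slice has mass 1 - 1 = 0. *)
  have succE : successors x = xsection (edge B n) x.
    apply/seteqP; split=> y; rewrite /xsection/= inE.
      by move=> [[x' y'] [Exy /= <-] <-].
    by move=> Exy; exists (x, y).
  have msucc : measurable (successors x).
    by rewrite succE; apply: measurable_xsection; exact: edge_measurable.
  have -> : xsection (~` edge B n) x = ~` successors x.
    by rewrite succE; apply/seteqP; split=> y; rewrite /xsection/= !inE.
  have PxT : P n x [set: level B n.+1] = 1 by exact: prob_kernel.
  have PxToo : P n x [set: level B n.+1] < +oo by rewrite PxT ltry.
  rewrite -setTD; apply: etrans (measureD _ msucc PxToo) _ => //.
  by rewrite setTI -[RHS](subee (x := 1))//; congr (_ - _);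
    [exact: PxT|exact: (P_consistent n x).1].
(* Both dominations hold at every point: for [P] by consistency, for [Q] by construction. *)
- split; apply: aeW => x; last exact: Qnu.
  by case: (P_consistent n x).
Qed.
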